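(* A completely regular semiring $S$ is a left band orthoring if and only if it is a distributive lattice of left rings.
   Context: A semiring $(S,+,\cdot)$ is a set with two associative binary operations such that $x(y+z)=xy+xz$ and $(x+y)z=xz+yz$ (no commutativity assumed). Rings are associative with commutative addition and need not have an identity. A semiring is completely regular if it is a union of subsemirings that are rings. $E^+(S)=\{e\in S\mid e+e=e\}$. An idempotent semiring is a semiring satisfying $x+x=x$ and $x\cdot x=x$. A left band semiring is an idempotent semiring on which Green's relation $\mathcal{L}^+$ of the additive reduct is the least distributive lattice congruence; equivalently, an idempotent semiring satisfying $x=x+yxy$. A left band orthoring is a completely regular semiring $S$ such that $E^+(S)$ is a subsemiring of $S$ and is a left band semiring. A left zero idempotent semiring is an idempotent semiring whose additive reduct is a left zero band ($x+y=x$). A left ring is a semiring that is (isomorphic to) a direct product of a left zero idempotent semiring and a ring. A distributive lattice is regarded as a semiring (join as $+$, meet as $\cdot$). $S$ is a distributive lattice of left rings if there is a semiring congruence $\rho$ on $S$ such that $S/\rho$ is a distributive lattice and each $\rho$-class is a left ring.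
   Formalization: ''Completely regular'' is taken to mean a disjoint union of subsemirings that are rings; with overlapping unions the claim fails, e.g. for the additive group Sym(3) with zero multiplication, which is a union of its cyclic subgroups. *)

(* Defs.v *)
From mathcomp Require Import all_boot boolp classical_sets.

Set Implicit Arguments.
Unset Strict Implicit.
Unset Printing Implicit Defensive.

Local Open Scope classical_set_scope.

(* Neither operation is assumed commutative, and there need be no 0 or 1. *)
Record semiring := Semiring {
  carrier :> Type;
  sadd : carrier -> carrier -> carrier;
  smul : carrier -> carrier -> carrier;
  saddA : associative sadd;
  smulA : associative smul;
  smulDr : right_distributive smul sadd;
  smulDl : left_distributive smul sadd }.

Declare Scope semiring_scope.
Delimit Scope semiring_scope with SR.
Local Open Scope semiring_scope.
Notation "x + y" := (sadd x y) : semiring_scope.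
Notation "x * y" := (smul x y) : semiring_scope.

Definition is_subsemiring (S : semiring) (A : set S) :=
  forall x y : S, A x -> A y -> A (x + y) /\ A (x * y).

Section Subsemiring.
Variables (S : semiring) (A : set S) (hA : is_subsemiring A).

Lemma sub_add_subproof (x y : A) : val x + val y \in A.
Proof. by apply/mem_set/(hA (set_valP x) (set_valP y)).1. Qed.

Lemma sub_mul_subproof (x y : A) : val x * val y \in A.
Proof. by apply/mem_set/(hA (set_valP x) (set_valP y)).2. Qed.

Definition sub_add (x y : A) : A := 
  exist (fun z => z \in A) _ (sub_add_subproof x y).
Definition sub_mul (x y : A) : A := 
  exist (fun z => z \in A) _ (sub_mul_subproof x y).

Lemma sub_addA : associative sub_add.
Proof. by move=> x y z; apply/val_inj; rewrite /= saddA. Qed.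
Lemma sub_mulA : associative sub_mul.
Proof. by move=> x y z; apply/val_inj; rewrite /= smulA. Qed.
Lemma sub_mulDr : right_distributive sub_mul sub_add.
Proof. by move=> x y z; apply/val_inj; rewrite /= smulDr. Qed.
Lemma sub_mulDl : left_distributive sub_mul sub_add.
Proof. by move=> x y z; apply/val_inj; rewrite /= smulDl. Qed.

Definition subsemiring : semiring :=
  Semiring sub_addA sub_mulA sub_mulDr sub_mulDl.

End Subsemiring.

Section Product.
Variables S T : semiring.

Definition prod_add (x y : S * T) : S * T := (x.1 + y.1, x.2 + y.2).
Definition prod_mul (x y : S * T) : S * T := (x.1 * y.1, x.2 * y.2).

Lemma prod_addA : associative prod_add.
Proof. by move=> x y z; rewrite /prod_add /= !saddA. Qed.
Lemma prod_mulA : associative prod_mul.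
Proof. by move=> x y z; rewrite /prod_mul /= !smulA. Qed.
Lemma prod_mulDr : right_distributive prod_mul prod_add.
Proof. by move=> x y z; rewrite /prod_mul /= !smulDr. Qed.
Lemma prod_mulDl : left_distributive prod_mul prod_add.
Proof. by move=> x y z; rewrite /prod_mul /= !smulDl. Qed.

Definition prod_semiring : semiring :=
  Semiring prod_addA prod_mulA prod_mulDr prod_mulDl.

End Product.

Definition semiring_iso (S T : semiring) :=
  exists f : S -> T, [/\ bijective f,
    forall x y, f (x + y) = f x + f y & forall x y, f (x * y) = f x * f y].

Record is_congruence (S : semiring) (rho : S -> S -> Prop) : Prop :=
  IsCongruence {
    congr_refl : forall x, rho x x;
    congr_sym : forall x y, rho x y -> rho y x;
    congr_trans : forall x y z, rho x y -> rho y z -> rho x z;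
    congrD : forall x x' y y', rho x x' -> rho y y' -> rho (x + y) (x' + y');
    congrM : forall x x' y y', rho x x' -> rho y y' -> rho (x * y) (x' * y') }.

Definition congr_class (S : semiring) (rho : S -> S -> Prop) (x : S) : set S :=
  [set y | rho x y].

Section Quotient.
Variables (S : semiring) (rho : S -> S -> Prop) (hrho : is_congruence rho).

Definition quot_carrier : Type :=
  [set C : set S | exists x, C = congr_class rho x].

Lemma quot_pi_subproof (x : S) :
  congr_class rho x \in [set C : set S | exists x, C = congr_class rho x].
Proof. by apply/mem_set; exists x. Qed.

Definition quot_pi (x : S) : quot_carrier :=
  exist (fun C => C \in [set C : set S | exists x, C = congr_class rho x])
    _ (quot_pi_subproof x).

Definition quot_repr (C : quot_carrier) : S := projT1 (cid (set_valP C)).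

Lemma quot_reprK (C : quot_carrier) : quot_pi (quot_repr C) = C.
Proof. by apply/val_inj; rewrite /quot_repr; case: cid. Qed.

Lemma quot_piP (x y : S) : quot_pi x = quot_pi y <-> rho x y.
Proof.
split=> [/(congr1 val) /= exy|rxy].
  have : congr_class rho y y by exact: (congr_refl hrho).
  by rewrite -exy.
apply/val_inj/seteqP; split=> z /= rz.
  exact: (congr_trans hrho (congr_sym hrho rxy)).
exact: (congr_trans hrho rxy).
Qed.

Lemma quot_pi_repr (x : S) : rho (quot_repr (quot_pi x)) x.
Proof. by apply/quot_piP; rewrite quot_reprK. Qed.

Definition quot_add (C D : quot_carrier) :=
  quot_pi (quot_repr C + quot_repr D).
Definition quot_mul (C D : quot_carrier) :=
  quot_pi (quot_repr C * quot_repr D).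

Lemma quot_piD x y : quot_pi (x + y) = quot_add (quot_pi x) (quot_pi y).
Proof.
by apply/quot_piP/(congrD hrho); apply/(congr_sym hrho)/quot_pi_repr.
Qed.

Lemma quot_piM x y : quot_pi (x * y) = quot_mul (quot_pi x) (quot_pi y).
Proof.
by apply/quot_piP/(congrM hrho); apply/(congr_sym hrho)/quot_pi_repr.
Qed.

Lemma quot_addA : associative quot_add.
Proof.
move=> C D E; rewrite -(quot_reprK C) -(quot_reprK D) -(quot_reprK E).
by rewrite -!quot_piD saddA.
Qed.
Lemma quot_mulA : associative quot_mul.
Proof.
move=> C D E; rewrite -(quot_reprK C) -(quot_reprK D) -(quot_reprK E).
by rewrite -!quot_piM smulA.
Qed.
Lemma quot_mulDr : right_distributive quot_mul quot_add.
Proof.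
move=> C D E; rewrite -(quot_reprK C) -(quot_reprK D) -(quot_reprK E).
by rewrite -!(quot_piM, quot_piD) smulDr.
Qed.
Lemma quot_mulDl : left_distributive quot_mul quot_add.
Proof.
move=> C D E; rewrite -(quot_reprK C) -(quot_reprK D) -(quot_reprK E).
by rewrite -!(quot_piM, quot_piD) smulDl.
Qed.

Definition quot_semiring : semiring :=
  Semiring quot_addA quot_mulA quot_mulDr quot_mulDl.

End Quotient.

Definition is_ring (S : semiring) :=
  commutative (@sadd S) /\
  exists z : S, forall x, z + x = x /\ exists y, y + x = z.

(* Distributivity of meet over join is a semiring axiom, and the dual law
   follows from it by absorption. *)
Definition is_distributive_lattice (S : semiring) :=
  [/\ commutative (@sadd S), commutative (@smul S),
      forall x y : S, x + x * y = x & forall x y : S, x * (x + y) = x].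

(* The union is disjoint. For semigroups a union of groups is automatically a
   disjoint union of groups, but for semirings disjointness has to be asked
   for: a nonabelian additive group with zero multiplication is the union of
   its cyclic subgroups, each of them a ring, and is not itself a ring. *)
Definition completely_regular (S : semiring) :=
  exists F : set (set S),
    [/\ \bigcup_(A in F) A = setT,
        trivIset F id &
        forall A, F A ->
          exists hA : is_subsemiring A, is_ring (subsemiring hA)].

Definition Eplus (S : semiring) : set S := [set e | e + e = e].

Definition is_idempotent (S : semiring) :=
  forall x : S, x + x = x /\ x * x = x.

Definition add_left_ideal (S : semiring) (a : S) : set S :=
  [set x | x = a \/ exists u, x = u + a].

Definition greenL (S : semiring) (a b : S) :=
  add_left_ideal a = add_left_ideal b.

Definition is_dl_congruence (S : semiring) (rho : S -> S -> Prop) :=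
  exists hrho : is_congruence rho, is_distributive_lattice (quot_semiring hrho).

Definition is_left_band_semiring (S : semiring) :=
  [/\ is_idempotent S,
      is_dl_congruence (@greenL S) &
      forall rho : S -> S -> Prop, is_dl_congruence rho ->
        forall x y, greenL x y -> rho x y].

Definition left_band_orthoring (S : semiring) :=
  completely_regular S /\
  exists hE : is_subsemiring (@Eplus S),
    is_left_band_semiring (subsemiring hE).

Definition is_left_zero_idempotent (S : semiring) :=
  is_idempotent S /\ forall x y : S, x + y = x.

Definition left_ring (S : semiring) :=
  exists L R : semiring,
    [/\ is_left_zero_idempotent L, is_ring R &
        semiring_iso S (prod_semiring L R)].

Definition distributive_lattice_of_left_rings (S : semiring) :=
  exists rho : S -> S -> Prop,
    is_dl_congruence rho /\
    forall x : S, exists hx : is_subsemiring (congr_class rho x),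
      left_ring (subsemiring hx).

(* Main.v *)
Require Import Defs.
From mathcomp Require Import all_boot boolp classical_sets.

Set Implicit Arguments.
Unset Strict Implicit.
Unset Printing Implicit Defensive.

Local Open Scope classical_set_scope.
Local Open Scope semiring_scope.

(** Every [x] lies in one of the rings that make up [S]; write [z x] for the
zero of that ring.  Multiplication by a fixed element is additive, hence
carries zeros to zeros: [z (x * y) = z x * y = x * z y = z x * z y] ([zeroMl],
[zeroMr], [zeroM]).  This is the lever for the whole proof.  Distributive
lattice congruences are handled as kernels of homomorphisms to distributive
lattices ([kernel_dl], [dl_kernel]).

Suppose first that the additive idempotents [E] form a left band semiring, and
let [q : E -> D] be the quotient by Green's relation L.  Then [q e = q f] means
[e + f = e] and [f + e = f].  The map [p x := q (z x)] is multiplicative by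
[zeroM].  It is additive because, with [w = x + y], expanding [z w * w] and
[z x * w] by distributivity gives [z w = z w * (z x + z y)] and
[z x * z w = z x + z x * z y]; in the lattice, the first puts [p w] below the
join of [p x] and [p y], and the second puts [p x], likewise [p y], below [p w].
So the kernel of [p] is a distributive lattice congruence.  Each of its
classes is a left ring by [class_left_ring]: with [e] an idempotent of the
class, send [y] to the pair of its zero and [e + y], as one does for a left group.

Conversely, let [q : S -> D] have left rings as its fibres.  An additive
idempotent of a left ring is a right unit for addition ([left_ring_idem_unit]),
so for idempotents [q e = q f] is equivalent to [e + f = e] and [f + e = f],
that is, to Green's relation on [E] ([greenL_idem], [left_zero_related]).
These two equations force [q e = q f] for every homomorphism [q] to a
distributive lattice, whence the minimality.  What remains is that [e + f] is
idempotent, and this follows by inserting right units: [e + f = g + e] with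
[g = z (e + f)] and [e + g = g]. *)

Definition elt (T : Type) (A : set T) (x : T) (Ax : A x) : A :=
  exist (fun y => y \in A) x (mem_set Ax).

(** * Distributive lattice congruences as kernels *)

Definition is_hom (S T : semiring) (q : S -> T) :=
  (forall x y, q (x + y) = q x + q y) /\ (forall x y, q (x * y) = q x * q y).

Lemma dl_idem (D : semiring) (hD : is_distributive_lattice D) (x : D) :
  x + x = x.
Proof. by case: hD => _ _ h1 h2; rewrite -{2}(h2 x x) h1. Qed.

Lemma dl_mul_idem (D : semiring) (hD : is_distributive_lattice D) (x : D) :
  x * x = x.
Proof. by case: hD => _ _ h1 h2; rewrite -{2}(h1 x x) h2. Qed.

(** The map need not be surjective: the lattice laws are identities, so they
pull back along the embedding of the quotient in [D]. *)
Lemma kernel_dl (S D : semiring) (q : S -> D) :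
  is_distributive_lattice D -> is_hom q ->
  is_dl_congruence (fun x y => q x = q y).
Proof.
move=> [addC mulC addK mulK] [qD qM].
have hq : is_congruence (fun x y => q x = q y).
  split=> //; first by move=> x y z ->.
    by move=> x x' y y' e1 e2; rewrite !qD e1 e2.
  by move=> x x' y y' e1 e2; rewrite !qM e1 e2.
exists hq.
have pi_ind (P : quot_semiring hq -> Prop) :
    (forall x, P (quot_pi (fun x y => q x = q y) x)) -> forall C, P C.
  by move=> hP C; rewrite -[C]quot_reprK; apply: hP.
by split; elim/pi_ind => x; elim/pi_ind => y;
  rewrite /= -?(quot_piD hq, quot_piM hq); apply/(quot_piP hq);
  rewrite !(qD, qM).
Qed.

Lemma dl_kernel (S : semiring) (rho : S -> S -> Prop) :
  is_dl_congruence rho -> exists (D : semiring) (q : S -> D),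
    [/\ is_distributive_lattice D, is_hom q &
        forall x y, rho x y <-> q x = q y].
Proof.
move=> [hrho hD]; exists (quot_semiring hrho), (quot_pi rho).
split=> //; first by split=> x y; [apply: quot_piD|apply: quot_piM].
by move=> x y; split=> /(quot_piP hrho).
Qed.

(** * The zero of the ring around an element *)

(** [z x] and [n x] are the zero and the opposite of [x] in its ring.  The last
field identifies each of the rings with a fibre of [z], so that the given
family of rings need not be mentioned again. *)
Record local_zero (S : semiring) (z n : S -> S) : Prop := LocalZero {
  zeroDl : forall x, z x + x = x;
  zeroDr : forall x, x + z x = x;
  oppDl : forall x, n x + x = z x;
  oppDr : forall x, x + n x = z x;
  zero_block : forall x, exists (A : set S) (hA : is_subsemiring A),
    is_ring (subsemiring hA) /\ forall y, A y <-> z y = z x }.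

(** An additive group contains a single idempotent; the hypotheses keep only the
halves of the group laws that force the two neutral elements to agree. *)
Lemma local_zero_unique (S : semiring) (e z x y n : S) :
  e + x = x -> y + x = e -> x + z = x -> x + n = z -> e = z.
Proof.
move=> ex yx xz xn.
have <- : e + z = e by rewrite -yx -saddA xz.
by rewrite -xn saddA ex.
Qed.

(** Disjointness of the rings is what makes [zero_block] hold: if [z y = z x],
then the rings around [x] and [y] share this zero, so they coincide. *)
Lemma completely_regular_local_zero (S : semiring) :
  completely_regular S -> exists z n : S -> S, local_zero z n.
Proof.
move=> [F [Fcover Fdisj Fring]].
have block x : exists A, F A /\ A x.
  have : [set: S] x by [].
  by rewrite -Fcover => -[A FA Ax]; exists A.
have ringP A : F A -> exists2 z, A z & forall x, A x ->
    exists n, [/\ z + x = x, x + z = x, n + x = z & x + n = z].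
  move=> FA; have [hA [addC [z hz]]] := Fring A FA.
  exists (val z); first exact: set_valP.
  move=> x Ax; set x' : A := elt Ax.
  have [/(congr1 val) /= zx [n nx]] := hz x'; exists (val n).
  have /(congr1 val) /= xz : @sadd (subsemiring hA) x' z = x'.
    by rewrite addC; case: (hz x').
  have /(congr1 val) /= xn : @sadd (subsemiring hA) x' n = z by rewrite addC.
  by move: nx => /(congr1 val) /= nx; split.
have zn x : exists p : S * S, [/\ p.1 + x = x, x + p.1 = x, p.2 + x = p.1,
    x + p.2 = p.1 & exists A, [/\ F A, A x & A p.1]].
  have [A [FA Ax]] := block x; have [z Az /(_ x Ax) [n []]] := ringP A FA.
  by exists (z, n); split=> //; exists A.
have [p hp] := choice zn.
exists (fun x => (p x).1), (fun x => (p x).2).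
split; try by move=> x; case: (hp x).
move=> x; have [zx xz nx xn [A [FA Ax Azx]]] := hp x.
have [hA rA] := Fring A FA; exists A, hA; split=> // y; split=> [Ay|eyx].
  have [z Az hz] := ringP A FA.
  have [n [h1 h2 h3 h4]] := hz y Ay; have [n' [h1' h2' h3' h4']] := hz x Ax.
  case: (hp y) => zy yz ny yn _.
  rewrite -(local_zero_unique h1 h3 yz yn).
  exact: (local_zero_unique h1' h3' xz xn).
have [zy yz ny yn [B [FB By Bzy]]] := hp y.
suff -> : A = B by [].
by apply: (Fdisj A B) => //; exists (p x).1; split=> //; rewrite -eyx.
Qed.

Section LocalZero.
Variables (S : semiring) (z n : S -> S) (hz : local_zero z n).

Lemma zero_unique (e x y : S) : e + x = x -> y + x = e -> z x = e.
Proof.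
move=> ex yx; apply/esym.
exact: (local_zero_unique ex yx (zeroDr hz x) (oppDr hz x)).
Qed.

Lemma zero_idem x : z x + z x = z x.
Proof. by rewrite -{2}(oppDr hz x) saddA (zeroDl hz) (oppDr hz). Qed.

Lemma zero_of_idem (e : S) : e + e = e -> z e = e.
Proof. by move=> ee; apply: (@zero_unique _ _ e). Qed.

Lemma zeroMl (x y : S) : z (x * y) = z x * y.
Proof.
by apply: (@zero_unique _ _ (n x * y : S));
  rewrite -smulDl ?(zeroDl hz) ?(oppDl hz).
Qed.

Lemma zeroMr (x y : S) : z (x * y) = x * z y.
Proof.
by apply: (@zero_unique _ _ (x * n y));
  rewrite -smulDr ?(zeroDl hz) ?(oppDl hz).
Qed.

Lemma zeroK x : z (z x) = z x.
Proof. exact/zero_of_idem/zero_idem. Qed.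

Lemma zeroM (x y : S) : z (x * y) = z x * z y.
Proof. by rewrite -(zeroK (x * y)) zeroMl zeroMr. Qed.

(** The square of [e] stays in the ring of [e], whose only additive idempotent
is [e]; this uses that the rings are closed under multiplication. *)
Lemma idem_mul (e : S) : e + e = e -> e * e = e.
Proof.
move=> ee; have [A [hA [_ hAz]]] := zero_block hz e.
have Ae : A e by apply/hAz.
by have /hAz := (hA e e Ae Ae).2; rewrite zeroM zero_of_idem.
Qed.

(** With [w = x + y], the right-hand side is [z (w * x) + z (w * y)], which
equals [z w * w = z w]. *)
Lemma zeroD_factor x y : z (x + y) = z (x + y) * (z x + z y).
Proof.
set w := x + y; rewrite smulDr -!zeroM !zeroMl -smulDr -/w -zeroMl zeroM.
by rewrite idem_mul ?zero_idem.
Qed.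

(** Modulo the lattice laws, this and its mirror image say that [z x] and [z y]
lie below [z (x + y)]. *)
Lemma zero_absorbl (x y : S) : z x * z (x + y) = z x + z x * z y.
Proof.
by rewrite -zeroM zeroMl smulDr -!zeroMl !zeroM zeroK idem_mul ?zero_idem.
Qed.

Lemma zero_absorbr (x y : S) : z y * z (x + y) = z y * z x + z y.
Proof.
by rewrite -zeroM zeroMl smulDr -!zeroMl !zeroM zeroK (idem_mul (zero_idem y)).
Qed.

End LocalZero.

(** * Left rings and Green's relation on idempotents *)

(** In a product of a left zero band and a ring, an additive idempotent has
second component zero, and its first component is absorbed. *)
Lemma left_ring_idem_unit (T : semiring) (x e : T) :
  left_ring T -> e + e = e -> x + e = x.
Proof.
move=> [L [R [[_ L0] [addC [r0 hr]] [f [bf fD _]]]]] ee.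
apply: (bij_inj bf); rewrite fD.
have /(congr1 snd) /= := fD e e; rewrite ee.
case: (f x) (f e) => [l r] [l' r'] /= rr.
have r'0 : r' = r0.
  have [_ [m mr]] := hr r'; rewrite -{1}(hr r').1 -[in RHS]mr {2}rr.
  by rewrite -mr saddA.
by rewrite /prod_add /= L0 r'0 addC (hr r).1.
Qed.

Lemma greenL_idem (E : semiring) (hE : is_idempotent E) (e f : E) :
  greenL e f <-> e + f = e /\ f + e = f.
Proof.
have sub (a b : E) : greenL a b -> a + b = a.
  move=> ab; have : add_left_ideal a a by left.
  by rewrite ab => -[->|[u ->]]; rewrite -?saddA (hE b).1.
split=> [ef|[ef fe]]; first by split; apply: sub => //; apply/esym.
apply/seteqP; split=> x [->|[u ->]]; right.
- by exists e.
- by exists (u + e); rewrite -saddA ef.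
- by exists f.
- by exists (u + f); rewrite -saddA fe.
Qed.

(** A commutative target identifies [e = e + f] with [f = f + e]. *)
Lemma left_zero_related (D E : semiring) (q : E -> D) (e f : E) :
  is_distributive_lattice D -> is_hom q ->
  e + f = e -> f + e = f -> q e = q f.
Proof.
by move=> [addC _ _ _] [qD _] ef fe; rewrite -ef -[in RHS]fe !qD addC.
Qed.

(** * From the idempotents to the whole semiring *)

(** [p] is any homomorphism to a distributive lattice that depends on [z x]
alone and whose fibres meet the idempotents in left zero bands. *)
Section KernelClasses.
Variables (S : semiring) (z n : S -> S) (hz : local_zero z n).
Variables (D : semiring) (hD : is_distributive_lattice D) (p : S -> D).
Hypothesis ph : is_hom p.
Hypothesis pz : forall x, p (z x) = p x.
Hypothesis left_zero :
  forall e f : S, e + e = e -> f + f = f -> p e = p f -> e + f = e.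

(** With [w = x + y], adding [n w] to [z x + w = w] gives [z x + z w = z w],
while [left_zero] evaluates the same sum to [z x]. *)
Lemma zeroD_class x y : p x = p y -> z (x + y) = z x.
Proof.
move=> xy; set w := x + y.
have wx : p w = p x by rewrite /w ph.1 -xy dl_idem.
have <- : z x + z w = z x.
  by apply: left_zero; rewrite ?(zero_idem hz) // ?pz ?wx.
rewrite -{2}(oppDr hz w) saddA.
have -> : z x + w = w by rewrite /w saddA (zeroDl hz).
by rewrite (oppDr hz).
Qed.

(** The left zero factor is the set [L] of idempotents of the class, and the
ring factor is the ring [A] around [x].  The isomorphism sends [y] to
[(z y, e + y)] with [e = z x], and its inverse is addition, [(l, a)] to [l + a].
It is multiplicative because in [(e + y) * (e + y')] the mixed terms
[e * y'] and [y * e] are idempotents of the class, absorbed on the right of [e]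
by [absorb]. *)
Lemma class_left_ring (x : S) :
  exists hx : is_subsemiring (congr_class (fun a b => p a = p b) x),
    left_ring (subsemiring hx).
Proof.
have hx : is_subsemiring (congr_class (fun a b => p a = p b) x).
  move=> a b /= xa xb.
  by rewrite /congr_class /= ph.1 ph.2 -xa -xb dl_idem // dl_mul_idem.
exists hx.
pose L : set S := [set f | f + f = f /\ p x = p f].
have hL : is_subsemiring L.
  move=> a b [aa xa] [bb xb].
  have ab : a + b = a by apply: left_zero; rewrite // -xa.
  rewrite ab; split; first by split.
  split; first by rewrite -smulDr bb.
  by rewrite ph.2 -xa -xb dl_mul_idem.
have [A [hA [rA hAz]]] := zero_block hz x.
have xe : p x = p (z x) by rewrite pz.
set e := z x in hAz xe.
have ee : e + e = e by apply: (zero_idem hz).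
have ze : z e = e by apply: (zero_of_idem hz).
have Adef y : A y -> p x = p y by move=> /hAz zy; rewrite xe -[RHS]pz zy.
have xT (y : subsemiring hx) : p x = p (val y) := set_valP y.
have fL y : p x = p y -> L (z y).
  by move=> xy; split; rewrite ?(zero_idem hz) ?pz.
have fA y : p x = p y -> A (e + y).
  by move=> xy; apply/hAz; rewrite zeroD_class -?xe.
have absorb f g : L f -> p x = p g -> g + f = g.
  move=> [ff xf] xg; rewrite -{1}(zeroDr hz g) -saddA.
  rewrite (@left_zero (z g) f) ?(zeroDr hz) ?(zero_idem hz) //.
  by rewrite pz -xg.
exists (subsemiring hL), (subsemiring hA); split=> //.
  split=> [f|f g]; last first.
    by apply/val_inj/absorb; [exact: set_valP|case: (set_valP f)].
  have [ff xf] := set_valP f.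
  by split; apply/val_inj => //=; apply: (idem_mul hz).
pose f (y : subsemiring hx) : prod_semiring (subsemiring hL) (subsemiring hA) :=
  (elt (fL _ (xT y)), elt (fA _ (xT y))).
have gP (u : prod_semiring (subsemiring hL) (subsemiring hA)) :
    congr_class (fun a b => p a = p b) x (val u.1 + val u.2).
  have [_ xl] := set_valP u.1; have := Adef _ (set_valP u.2).
  by rewrite /congr_class /= ph.1 => <-; rewrite -xl dl_idem.
exists f; split.
- exists (fun u => elt (gP u) : subsemiring hx).
    move=> y; apply/val_inj => /=.
    rewrite saddA (_ : z (val y) + e = z (val y)) ?(zeroDl hz) //.
    by apply: absorb; [split|rewrite pz].
  move=> [l a]; congr (_, _); apply/val_inj => /=.
    have [ll xl] := set_valP l.
    rewrite zeroD_class ?(zero_of_idem hz ll) // -xl.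
    exact/Adef/set_valP.
  have /hAz za := set_valP a.
  by rewrite saddA (@absorb _ e (set_valP l)) // -za (zeroDl hz).
- move=> y y'; congr (_, _); apply/val_inj => /=.
    rewrite zeroD_class; last by rewrite -!xT.
    by rewrite (absorb _ _ (fL _ (xT y'))) // pz; apply: xT.
  by rewrite !saddA -(saddA e (val y) e) (@absorb e (val y)).
- move=> y y'; congr (_, _); apply/val_inj => /=; first exact: (zeroM hz).
  rewrite smulDl !smulDr (idem_mul hz ee) !saddA.
  have Lm a b : p x = p a -> p x = p b -> z (a * b) = a * b -> L (a * b).
    move=> xa xb <-; apply: (fL (a * b)).
    by rewrite ph.2 -xa -xb dl_mul_idem.
  rewrite (@absorb (e * val y') e) //; last first.
    by apply: Lm; rewrite // (zeroMl hz) ze.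
  by rewrite (@absorb (val y * e) e) //; apply: Lm; rewrite // (zeroMr hz) ze.
Qed.

End KernelClasses.

(** The homomorphism [p] to the lattice of L-classes of idempotents is the one
whose kernel decomposes [S]. *)
Lemma left_band_orthoring_lattice (S : semiring) :
  left_band_orthoring S -> distributive_lattice_of_left_rings S.
Proof.
move=> [hS [hE [idemE Edl _]]].
have [z [n hz]] := completely_regular_local_zero hS.
have [D [q [hD qh qP]]] := dl_kernel Edl; have [qD qM] := qh.
have [addC mulC addK mulK] := hD.
pose zE (x : S) : subsemiring hE := elt (zero_idem hz x : Eplus _).
have zEM x y : zE (x * y) = zE x * zE y by apply/val_inj/(zeroM hz).
pose p x := q (zE x).
have pM x y : p (x * y) = p x * p y by rewrite /p zEM qM.
have pD x y : p (x + y) = p x + p y.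
  have factor : zE (x + y) = zE (x + y) * (zE x + zE y).
    exact/val_inj/(zeroD_factor hz).
  have absx : zE x * zE (x + y) = zE x + zE x * zE y.
    exact/val_inj/(zero_absorbl hz).
  have absy : zE y * zE (x + y) = zE y * zE x + zE y.
    exact/val_inj/(zero_absorbr hz).
  have px : p x * p (x + y) = p x by rewrite /p -qM absx qD qM addK.
  have py : p y * p (x + y) = p y.
    by rewrite /p -qM absy qD qM addC addK.
  (* [p w = p w * (p x + p y) = p x + p y] for [w = x + y]. *)
  rewrite /p factor qM qD -/(p x) -/(p y) -/(p (x + y)) mulC smulDl.
  by rewrite px py.
have pz x : p (z x) = p x.
  by rewrite /p; congr (q _); apply/val_inj/(zeroK hz).
have left_zero e f : e + e = e -> f + f = f -> p e = p f -> e + f = e.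
  move=> ee ff; rewrite /p => /qP /(greenL_idem idemE) [/(congr1 val) /= + _].
  by rewrite !(zero_of_idem hz).
exists (fun x y => p x = p y); split; first exact: kernel_dl.
exact: (class_left_ring hz hD (conj pD pM) pz left_zero).
Qed.

(** * From the lattice of left rings to the idempotents *)

(** The step that is not formal is [closedD]: [e + f] lies in a class of its
own, away from [e] and [f], so its idempotency does not follow from the
structure of a single class. *)
Lemma lattice_left_band_orthoring (S : semiring) (hS : completely_regular S) :
  distributive_lattice_of_left_rings S -> left_band_orthoring S.
Proof.
move=> [rho [rhodl left_class]]; split=> //.
have [z [n hz]] := completely_regular_local_zero hS.
have [D [q [hD qh qP]]] := dl_kernel rhodl; have [qD qM] := qh.
have [addC mulC addK mulK] := hD.
have idem_unit x e : q x = q e -> e + e = e -> x + e = x.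
  move=> /qP xe ee; have [hx lx] := left_class x.
  have xx : congr_class rho x x by apply/qP.
  have := @left_ring_idem_unit (subsemiring hx) (elt xx) (elt xe) lx.
  by move=> h; apply: (congr1 val (h _)); apply/val_inj.
have qz x : q (z x) = q x.
  have zx : q (z x) = q x + q (n x) by rewrite -qD (oppDr hz).
  by rewrite -[RHS](congr1 q (zeroDr hz x)) qD zx saddA dl_idem.
have closedD (e f : S) : e + e = e -> f + f = f -> (e + f) + (e + f) = e + f.
  move=> ee ff; set a := e + f; set g := z a; set h := z (f + e).
  have hh : h + h = h by apply: (zero_idem hz).
  (* [a] and [f + e] begin with [e] and [f], hence so do their zeros. *)
  have eg : e + g = g.
    by rewrite /g -(oppDr hz) saddA /a (saddA e) ee.
  have fh : f + h = h.
    by rewrite /h -(oppDr hz) saddA (saddA f) ff.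
  (* [h] is a right unit for [a], and [f + h = h], so the summand [f] of [a] can
     be replaced by [h], which in turn is a right unit for [g + e]. *)
  have ah : a = e + h.
    by rewrite -[LHS](@idem_unit a h) // ?qz ?qD 1?addC // /a -saddA fh.
  have age : a = g + e.
    rewrite -[LHS](zeroDl hz a) -/g ah saddA idem_unit //.
    by rewrite qD !qz /a !qD -saddA (addC (q f)) saddA dl_idem.
  by rewrite age saddA -(saddA g e g) eg (zero_idem hz).
have hE : is_subsemiring (@Eplus S).
  move=> e f ee ff; split; first exact: closedD.
  by rewrite /Eplus /= -smulDr ff.
exists hE.
have idemE : is_idempotent (subsemiring hE).
  move=> e; have ee := set_valP e.
  by split; apply/val_inj => //=; apply: (idem_mul hz).
have qE : is_hom (q \o val : subsemiring hE -> D).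
  by split=> x y /=; [apply: qD|apply: qM].
split=> //.
  suff -> : @greenL (subsemiring hE) = fun e f => (q \o val) e = (q \o val) f.
    exact: kernel_dl.
  apply/funext => e; apply/funext => f; apply/propext.
  rewrite greenL_idem //; split=> [[ef fe]|/= qef].
    exact: (left_zero_related hD qE).
  by split; apply/val_inj; apply: idem_unit => //;
    apply: (set_valP (_ : @Eplus S)).
move=> sigma /dl_kernel [D' [q' [hD' q'h q'P]]] e f.
by move=> /(greenL_idem idemE) [ef fe]; apply/q'P/(left_zero_related hD' q'h).
Qed.

Theorem theorem4p3 (S : semiring) (hS : completely_regular S) :
  left_band_orthoring S <-> distributive_lattice_of_left_rings S.
Proof.
split; first exact: left_band_orthoring_lattice.
exact: lattice_left_band_orthoring.
Qed.
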